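(* Let $G$ be a claw-free graph of order $n$ with minimum degree $\delta(G)$. Then the following statements hold. (i) Each of $\gamma_{t}^{oi}(G)$, $\gamma_{2}^{oi}(G)$ and $\gamma_{d}^{oi}(G)$ is at least $\dfrac{\delta(G)\,n}{\delta(G)+2}$ (where the inequalities for $\gamma_{t}^{oi}(G)$ and $\gamma_{d}^{oi}(G)$ are asserted when $G$ has no isolated vertices, so that these parameters are defined). (ii) If $\delta(G)\geq 3$, then $\gamma_{t}^{oi}(G)=\gamma_{2}^{oi}(G)=\gamma_{d}^{oi}(G)$.
   Context: All graphs are finite and simple. A graph is claw-free if it has no induced subgraph isomorphic to the star $K_{1,3}$. $N[v]$ denotes the closed neighborhood of $v$. Let $S\subseteq V(G)$ be such that $V(G)\setminus S$ is an independent set. Then $S$ is: a total outer-independent dominating (TOID) set if every vertex of $V(G)$ has at least one neighbor in $S$; a $2$-outer-independent dominating ($2$OID) set if every vertex of $V(G)\setminus S$ has at least two neighbors in $S$; a double outer-independent dominating (DOID) set if $|N[v]\cap S|\geq2$ for all $v\in V(G)$. The numbers $\gamma_{t}^{oi}(G)$, $\gamma_{2}^{oi}(G)$, $\gamma_{d}^{oi}(G)$ are the smallest cardinalities of a TOID, $2$OID, DOID set of $G$, respectively; $\gamma_{t}^{oi}(G)$ and $\gamma_{d}^{oi}(G)$ are defined exactly when $G$ has no isolated vertices. *)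

(* Defs.v *)
From mathcomp Require Import all_boot all_order all_algebra.

Set Implicit Arguments.
Unset Strict Implicit.
Unset Printing Implicit Defensive.

(* A finite simple graph is a symmetric irreflexive relation e on a finType;  *)
(* symmetry and irreflexivity are hypotheses of the theorem, the definitions  *)
(* below make sense for any relation.                                         *)

Definition nbhd (T : finType) (e : rel T) (v : T) : {set T} :=
  [set u | e v u].

Definition closed_nbhd (T : finType) (e : rel T) (v : T) : {set T} :=
  v |: nbhd e v.

Definition degree (T : finType) (e : rel T) (v : T) : nat := #|nbhd e v|.

(* In a simple graph every degree is < #|T|, so the default value #|T| never  *)
(* affects the minimum when T is nonempty; for T empty this gives 0.          *)
Definition min_degree (T : finType) (e : rel T) : nat :=
  \big[minn/#|T|]_(v : T) degree e v.

Definition no_isolated (T : finType) (e : rel T) : Prop :=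
  forall v : T, exists u : T, e v u.

Definition star (k : nat) : rel 'I_k.+1 :=
  fun i j => (i == ord0) (+) (j == ord0).

(* f is an isomorphism from h onto the subgraph of e induced by its image.    *)
Definition has_induced (U T : finType) (h : rel U) (e : rel T) : Prop :=
  exists2 f : U -> T, injective f & forall x y, e (f x) (f y) = h x y.

Definition claw_free (T : finType) (e : rel T) : Prop :=
  ~ has_induced (@star 3) e.

Definition independent (T : finType) (e : rel T) (A : {set T}) : bool :=
  [forall u in A, forall v in A, ~~ e u v].

Definition TOID (T : finType) (e : rel T) (S : {set T}) : bool :=
  independent e (~: S) && [forall v, exists u in S, e v u].

Definition two_OID (T : finType) (e : rel T) (S : {set T}) : bool :=
  independent e (~: S) && [forall v in ~: S, 2 <= #|nbhd e v :&: S|].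

Definition DOID (T : finType) (e : rel T) (S : {set T}) : bool :=
  independent e (~: S) && [forall v, 2 <= #|closed_nbhd e v :&: S|].

(* setT is always a two_OID set, and it is a TOID and a DOID set as soon as   *)
(* there is no isolated vertex. Otherwise no TOID or DOID set exists, and     *)
(* gamma_toi and gamma_doi have the meaningless value #|T|.                   *)
Definition gamma_toi (T : finType) (e : rel T) : nat :=
  #|[arg min_(S < [set: T] | TOID e S) #|S|]|.

Definition gamma_2oi (T : finType) (e : rel T) : nat :=
  #|[arg min_(S < [set: T] | two_OID e S) #|S|]|.

Definition gamma_doi (T : finType) (e : rel T) : nat :=
  #|[arg min_(S < [set: T] | DOID e S) #|S|]|.

(* Main.v *)
Require Import Defs.
From mathcomp Require Import all_boot all_order all_algebra.
Import Order.TTheory GRing.Theory Num.Theory.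

(** Only the independence of the complement of [S] matters.  In a claw-free
    graph a vertex has at most two neighbours in an independent set, since
    three of them would span a claw with it ([claw_free_indep_nbhd]).  On the
    other hand, a vertex outside [S] has all its neighbours in [S].

    For the lower bound, count the edges between [S] and its complement: each
    vertex outside [S] contributes at least [delta] of them, each vertex of [S]
    receives at most two, so [delta * (n - #|S|) <= 2 * #|S|]
    ([claw_free_outer_indep_bound]), which rearranges to the claim.

    If [delta >= 3], a vertex outside [S] has at least three neighbours in [S],
    and a vertex of [S] has at most two neighbours outside [S], hence at least
    one inside.  So every [S] with independent complement is at once TOID, 2OID
    and DOID, and the three parameters minimise [#|S|] over the same family. *)

Section Graph.
Set Implicit Arguments.
Unset Strict Implicit.
Variables (T : finType) (e : rel T).

Lemma independentP (A : {set T}) :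
  reflect {in A &, forall u v, ~~ e u v} (independent e A).
Proof.
apply: (iffP forall_inP) => [indA u v uA vA | indA u uA].
  by move/forall_inP: (indA u uA); apply.
by apply/forall_inP => v vA; apply: indA.
Qed.

Lemma min_degree_le (v : T) : min_degree e <= degree e v.
Proof. by rewrite /min_degree -minEnat -leEnat; apply: bigmin_le. Qed.

Lemma independentS (A B : {set T}) :
  A \subset B -> independent e B -> independent e A.
Proof.
move=> /subsetP sAB /independentP indB; apply/independentP => u v uA vA.
by apply: indB; apply: sAB.
Qed.

Lemma outer_indep_nbhd_sub (S : {set T}) (v : T) :
  independent e (~: S) -> v \notin S -> nbhd e v \subset S.
Proof.
move=> /independentP indS vS; apply/subsetP => u; rewrite inE => evu.
by apply: contraLR evu => uS; apply: indS; rewrite inE.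
Qed.

(** Counting the pairs of adjacent vertices between [A] and [B] from both
    sides. *)
Lemma sum_nbhd_exchange (A B : {set T}) : symmetric e ->
  \sum_(v in A) #|nbhd e v :&: B| = \sum_(u in B) #|nbhd e u :&: A|.
Proof.
move=> e_sym.
have cardE (C : {set T}) v : #|nbhd e v :&: C| = \sum_(u in C) e v u.
  rewrite -sum1_card big_mkcond [RHS]big_mkcond; apply: eq_bigr => u _ /=.
  by rewrite !inE; case: (e v u); case: (u \in C).
under eq_bigr do rewrite cardE; under [RHS]eq_bigr do rewrite cardE.
by rewrite exchange_big /=; do 2!apply: eq_bigr => ? _; rewrite e_sym.
Qed.

Hypotheses (e_sym : symmetric e) (e_irr : irreflexive e).

Lemma has_induced_star (k : nat) (v : T) (A : {set T}) :
    independent e A -> A \subset nbhd e v -> k <= #|A| ->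
  has_induced (@star k) e.
Proof.
move=> /independentP indA /subsetP sAv leqkA.
have evA u : u \in A -> e v u by move/sAv; rewrite inE.
pose leaf (j : 'I_k) : T := enum_val (widen_ord leqkA j).
have leafA j : leaf j \in A by apply: enum_valP.
(* The centre [ord0] of the star goes to [v], its leaves into [A]. *)
pose f (i : 'I_k.+1) := oapp leaf v (unlift ord0 i).
have f0 : f ord0 = v by rewrite /f unlift_none.
have fS j : f (lift ord0 j) = leaf j by rewrite /f liftK.
have v_leaf j : v != leaf j.
  by apply: contraFneq (e_irr v) => {2}->; apply: evA.
exists f => i j; case: (unliftP ord0 i) => [i'|] ->;
    case: (unliftP ord0 j) => [j'|] ->; rewrite ?f0 ?fS /star //=.
- by move=> /enum_val_inj/(congr1 val) /= ij; congr lift; apply: val_inj.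
- by move/eqP; rewrite eq_sym (negPf (v_leaf i')).
- by move/eqP; rewrite (negPf (v_leaf j')).
- by apply/negbTE/indA.
- by rewrite e_sym evA.
- by rewrite evA.
Qed.

Hypothesis e_cf : claw_free e.

Lemma claw_free_indep_nbhd (v : T) (A : {set T}) :
  independent e A -> #|nbhd e v :&: A| <= 2.
Proof.
move=> indA; rewrite leqNgt; apply/negP => gt2; apply: e_cf.
apply: has_induced_star gt2; last exact: subsetIl.
exact: independentS (subsetIr _ _) indA.
Qed.

(** Double counting of the edges between [S] and its complement. *)
Lemma claw_free_outer_indep_bound (S : {set T}) :
    independent e (~: S) ->
  min_degree e * #|T| <= (min_degree e + 2) * #|S|.
Proof.
move=> indS; rewrite -(cardsC S) mulnDr mulnDl leq_add2l [2 * _]mulnC mulnC.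
rewrite -!sum_nat_const.
apply: leq_trans (_ : \sum_(v in ~: S) #|nbhd e v :&: S| <= _).
  apply: leq_sum => v; rewrite inE => vS.
  by rewrite (setIidPl (outer_indep_nbhd_sub indS vS)) min_degree_le.
rewrite sum_nbhd_exchange //; apply: leq_sum => u _.
exact: claw_free_indep_nbhd.
Qed.

Section LargeMinDegree.
Hypothesis delta_ge3 : 3 <= min_degree e.
Variable S : {set T}.
Hypothesis indS : independent e (~: S).

Lemma outer_indep_card_nbhd_out (v : T) :
  v \notin S -> 3 <= #|nbhd e v :&: S|.
Proof.
move=> vS; rewrite (setIidPl (outer_indep_nbhd_sub indS vS)).
exact: leq_trans delta_ge3 (min_degree_le v).
Qed.

(** At most two of the at least three neighbours of [v] lie outside [S]. *)
Lemma outer_indep_card_nbhd (v : T) : 1 <= #|nbhd e v :&: S|.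
Proof.
have := leq_trans delta_ge3 (min_degree_le v).
rewrite /degree -(cardsID S) setDE => deg3.
have := leq_trans deg3 (leq_add (leqnn _) (claw_free_indep_nbhd v indS)).
by rewrite -(addn1 2) addnC leq_add2r.
Qed.

End LargeMinDegree.

Lemma TOID_outer_indep : 3 <= min_degree e ->
  TOID e =1 fun S => independent e (~: S).
Proof.
move=> d3 S; apply/andb_idr => indS; apply/forallP => v; apply/exists_inP.
have /card_gt0P[u] := outer_indep_card_nbhd d3 indS v.
by rewrite !inE => /andP[evu uS]; exists u.
Qed.

Lemma two_OID_outer_indep : 3 <= min_degree e ->
  two_OID e =1 fun S => independent e (~: S).
Proof.
move=> d3 S; apply/andb_idr => indS; apply/forall_inP => v; rewrite inE => vS.
exact: (ltnW (outer_indep_card_nbhd_out d3 indS vS)).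
Qed.

Lemma DOID_outer_indep : 3 <= min_degree e ->
  DOID e =1 fun S => independent e (~: S).
Proof.
move=> d3 S; apply/andb_idr => indS; apply/forallP => v.
rewrite /closed_nbhd setIUl; have [vS | vS] := boolP (v \in S).
  have v_out : v \notin nbhd e v :&: S by rewrite !inE e_irr.
  rewrite (setIidPl _) ?sub1set // cardsU1 v_out add1n ltnS.
  exact: (outer_indep_card_nbhd d3 indS v).
apply: leq_trans (ltnW (outer_indep_card_nbhd_out d3 indS vS)) _.
exact: subset_leq_card (subsetUr _ _).
Qed.

Lemma independent_setC_setT : independent e (~: setT).
Proof. by apply/independentP => u v; rewrite setCT inE. Qed.

Lemma eq_arg_min_card (P Q : pred {set T}) (A : {set T}) :
  P =1 Q -> [arg min_(S < A | P S) #|S|] = [arg min_(S < A | Q S) #|S|].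
Proof.
move=> eqPQ; congr odflt; apply: eq_pick => S /=; rewrite eqPQ; congr andb.
by apply: eq_forallb => S'; rewrite eqPQ.
Qed.

End Graph.

Local Open Scope ring_scope.

Theorem theorem4p2 (T : finType) (e : rel T)
    (e_sym : symmetric e) (e_irr : irreflexive e) (e_cf : claw_free e) :
  let n := #|T| in
  let delta := min_degree e in
  let bound : rat := (delta%:R * n%:R) / (delta%:R + 2%:R) in
  [/\ no_isolated e -> bound <= (gamma_toi e)%:R,
      bound <= (gamma_2oi e)%:R &
      no_isolated e -> bound <= (gamma_doi e)%:R]
  /\ ((3 <= delta)%N ->
        gamma_toi e = gamma_2oi e /\ gamma_2oi e = gamma_doi e).
Proof.
move=> n delta bound.
have indT := independent_setC_setT e.
have boundS (S : {set T}) : independent e (~: S) -> bound <= #|S|%:R.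
  move=> indS; rewrite /bound -natrD ler_pdivrMr; last by rewrite ltr0n addn2.
  by rewrite -!natrM ler_nat [(#|S| * _)%N]mulnC claw_free_outer_indep_bound.
split; last first.
  move=> d3; rewrite /gamma_toi /gamma_2oi /gamma_doi.
  rewrite (eq_arg_min_card _ (TOID_outer_indep e_sym e_irr e_cf d3)).
  rewrite (eq_arg_min_card _ (two_OID_outer_indep d3)).
  by rewrite (eq_arg_min_card _ (DOID_outer_indep e_sym e_irr e_cf d3)).
split.
- move=> iso; rewrite /gamma_toi; case: arg_minnP => [|S /andP[indS _] _].
    rewrite /TOID indT; apply/forallP => v; apply/exists_inP.
    by have [u evu] := iso v; exists u.
  exact: boundS.
- rewrite /gamma_2oi; case: arg_minnP => [|S /andP[indS _] _].
    by rewrite /two_OID indT; apply/forall_inP => v; rewrite setCT inE.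
  exact: boundS.
- move=> iso; rewrite /gamma_doi; case: arg_minnP => [|S /andP[indS _] _].
    rewrite /DOID indT; apply/forallP => v; have [u evu] := iso v.
    rewrite setIT cardsU1 inE e_irr add1n ltnS card_gt0.
    by apply/set0Pn; exists u; rewrite inE.
  exact: boundS.
Qed.
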